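(* Let $\mathcal X\subseteq\mathbb R^d$ and let $P,\widehat P$ be probability measures on $\mathcal X$ with densities $p,\hat p$ and the same support. Let $f,g:[0,\infty)\to\mathbb R$ be convex lower semi-continuous functions with $f(1)=g(1)=0$, such that $f$ is $\mu$-strongly convex ($\mu>0$) and $g$ is $\sigma$-Lipschitz. Let $T:\mathcal X\to\mathbb R$ be measurable and let $r(x)=\nabla f^*(T(x))$. Let $\epsilon\ge 0$. If $$\mathcal D_f(P\Vert\widehat P)-\mathcal D^{\mathrm{dual}}_{f,T}(P\Vert\widehat P)\le\epsilon,$$ then $$\left|\mathcal D_g(P\Vert\widehat P)-\mathcal D^{\mathrm{primal}}_{g,T}(P\Vert\widehat P)\right|\le\sigma\sqrt{\frac{2\epsilon}{\mu}} .$$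
   Context: Densities are with respect to Lebesgue measure; sharing the same support means $p>0$ exactly where $\hat p>0$ (up to null sets), and integrals are over this common support. For a convex lower semi-continuous $h:[0,\infty)\to\mathbb R$ with $h(1)=0$, the $h$-divergence is $\mathcal D_h(P\Vert\widehat P)=\int_{\mathcal X}\hat p(x)\,h\!\left(\frac{p(x)}{\hat p(x)}\right)dx$. The convex conjugate is $f^*(t)=\sup_{u\ge 0}\{tu-f(u)\}$ ($f$ being $+\infty$ outside $[0,\infty)$); since $f$ is strongly convex, $f^*$ is finite and differentiable on $\mathbb R$ and $\nabla f^*$ takes values in $[0,\infty)$. The dual estimate is $\mathcal D^{\mathrm{dual}}_{f,T}(P\Vert\widehat P)=\mathbb E_{x\sim P}[T(x)]-\mathbb E_{x\sim\widehat P}[f^*(T(x))]$. The primal estimate is $\mathcal D^{\mathrm{primal}}_{g,T}(P\Vert\widehat P)=\int_{\mathcal X}\hat p(x)\,g(r(x))\,dx$ with $r(x)=\nabla f^*(T(x))$. It is understood that $\mathcal D_f(P\Vert\widehat P)$ is finite and that $T$ is $P$-integrable and $f^*\circ T$ is $\widehat P$-integrable, so that the difference in the hypothesis is well defined. $f$ is $\mu$-strongly convex if $u\mapsto f(u)-\frac{\mu}{2}u^2$ is convex. *)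

(* Defs.v *)
From HB Require Import structures.
From mathcomp Require Import all_boot all_order all_algebra.
From mathcomp Require Import all_classical all_reals all_analysis.

Set Implicit Arguments.
Unset Strict Implicit.
Unset Printing Implicit Defensive.

Import Order.TTheory GRing.Theory Num.Theory.
Import numFieldNormedType.Exports.

Local Open Scope classical_set_scope.
Local Open Scope ring_scope.

(* R^d is [d.-tuple R]; its library sigma-algebra is generated by the
   coordinates, i.e. it is the Borel sigma-algebra.  Lebesgue measure on it is
   the iterated product of [lebesgue_measure], transported from
   [R * n.-tuple R] to [n.+1.-tuple R]. *)
Section lebesgue_tuple.
Context {R : realType}.

Definition tuple_cons n (xt : measurableTypeR R * n.-tuple R) : n.+1.-tuple R :=
  [tuple of xt.1 :: xt.2].

Lemma measurable_tuple_cons n : measurable_fun [set: _] (@tuple_cons n).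
Proof.
apply: (@measurable_cons _ _ _ R
  (fun xt : measurableTypeR R * n.-tuple R => xt.1 : R) n (fun xt => xt.2)).
  exact: measurable_fst.
exact: measurable_snd.
Qed.

Section cons.
Variables (n : nat) (mu : {sigma_finite_measure set (n.-tuple R) -> \bar R}).

Definition lebesgue_cons : set (n.+1.-tuple R) -> \bar R :=
  pushforward (lebesgue_measure \x mu)%E (@tuple_cons n).

Let lebesgue_cons0 : lebesgue_cons set0 = 0%E.
Proof. by rewrite /lebesgue_cons /pushforward preimage_set0 measure0. Qed.

Let lebesgue_cons_ge0 A : (0 <= lebesgue_cons A)%E.
Proof. by rewrite /lebesgue_cons /pushforward measure_ge0. Qed.

Let lebesgue_cons_sigma_additive : semi_sigma_additive lebesgue_cons.
Proof.
move=> F mF tF mUF; rewrite /lebesgue_cons /pushforward preimage_bigcup.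
have mp B : measurable B -> measurable (@tuple_cons n @^-1` B).
  by move=> mB; rewrite -[X in measurable X]setTI; exact: measurable_tuple_cons.
apply: measure_semi_sigma_additive.
- by move=> k; exact: mp.
- apply/trivIsetP => /= i j _ _ ij; rewrite -preimage_setI.
  by move/trivIsetP : tF => /(_ _ _ _ _ ij) ->//; rewrite preimage_set0.
- by rewrite -preimage_bigcup; exact: mp.
Qed.

HB.instance Definition _ := isMeasure.Build _ _ _ lebesgue_cons
  lebesgue_cons0 lebesgue_cons_ge0 lebesgue_cons_sigma_additive.

Let lebesgue_cons_sigma_finite : sigma_finite setT lebesgue_cons.
Proof.
have /sigma_finiteP[F [FT ndF Foo]] := sigma_finiteT (@lebesgue_measure R).
have /sigma_finiteP[G [GT ndG Goo]] := sigma_finiteT mu.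
have mbox (A : set R) (B : set (n.-tuple R)) : measurable A -> measurable B ->
    measurable [set t : n.+1.-tuple R | A (thead t) /\ B [tuple of behead t]].
  move=> mA mB; rewrite (_ : [set _ | _] =
      (fun t : n.+1.-tuple R => tnth t ord0) @^-1` A `&`
      (fun t : n.+1.-tuple R => [tuple of behead t]) @^-1` B)//.
  apply: measurableI; rewrite -[X in measurable X]setTI.
    exact: measurable_tnth.
  exact: measurable_behead.
exists (fun k => [set t | F k (thead t) /\ G k [tuple of behead t]]).
  apply/esym; rewrite -subTset => t _.
  have [i _ Fi] : (\bigcup_i F i) (thead t) by rewrite -FT.
  have [j _ Gj] : (\bigcup_i G i) [tuple of behead t] by rewrite -GT.
  exists (maxn i j) => //=; split.
    by move: Fi; exact/subsetPset/ndF/leq_maxl.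
  by move: Gj; exact/subsetPset/ndG/leq_maxr.
move=> k; have [mFk Fk] := Foo k; have [mGk Gk] := Goo k.
split; first exact: mbox.
rewrite /lebesgue_cons /pushforward.
rewrite (_ : _ @^-1` _ = F k `*` G k); last first.
  apply/seteqP; split => -[x t] /=; rewrite theadE (_ : [tuple of _] = t)//;
    exact/val_inj.
by rewrite product_measure1E// lte_mul_pinfty// ge0_fin_numE.
Qed.

HB.instance Definition _ := Measure_isSigmaFinite.Build _ _ _ lebesgue_cons
  lebesgue_cons_sigma_finite.

End cons.

Fixpoint lebesgue_tuple n : {sigma_finite_measure set (n.-tuple R) -> \bar R} :=
  if n is n'.+1 then lebesgue_cons (lebesgue_tuple n') else \d_([tuple] : 0.-tuple R).

Lemma lebesgue_tuple_box n (A : 'I_n -> set R) :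
  (forall i, measurable (A i)) ->
  lebesgue_tuple n [set t | forall i, A i (tnth t i)] =
  (\prod_(i < n) lebesgue_measure (A i))%E.
Proof.
elim: n A => [|n IHn] A mA.
  by rewrite big_ord0 /= diracE mem_set// => -[].
have mB : measurable [set t : n.-tuple R | forall i, A (lift ord0 i) (tnth t i)].
  rewrite (_ : [set _ | _] =
      \bigcap_(i in [set: 'I_n]) ((@tnth _ R)^~ i @^-1` A (lift ord0 i))).
    by apply: fin_bigcap_measurable => // i _; rewrite -[X in measurable X]setTI;
      exact: measurable_tnth.
  by apply/seteqP; split => t /= h i; [move=> _|]; exact: h.
rewrite big_ord_recl -IHn// /= /lebesgue_cons /pushforward.
rewrite -product_measure1E//; last exact: mA.
congr product_measure1.
apply/seteqP; split => -[x t] /=.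
  move=> h; split=> [|i]; first exact: (h ord0).
  by have := h (lift ord0 i); rewrite tnthS.
move=> -[hx ht] i; case: (unliftP ord0 i) => [j ->|->//].
by rewrite tnthS; exact: ht.
Qed.

End lebesgue_tuple.

Section generators.
Context {R : realType}.
Implicit Types (f : R -> R) (t u : R).

(* A function on [0, +oo[ is a total [f : R -> R] whose values on ]-oo, 0[ are
   never used.  [ext_pinfty f] is its extension by +oo, which is lower
   semicontinuous on R iff [f] is so on the closed set [0, +oo[. *)
Definition nnegR : set R := `[0, +oo[%classic.

Definition ext_pinfty f u : \bar R := if 0 <= u then (f u)%:E else +oo%E.

Definition convex_lsc f :=
  convex_function (E := R^o) nnegR f /\ lower_semicontinuous (ext_pinfty f).

Definition strongly_convex (mu : R) f :=
  convex_function (E := R^o) nnegR (fun u => f u - mu / 2 * u ^+ 2).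

Definition conjugate f t : \bar R :=
  ereal_sup [set (t * u - f u)%:E | u in nnegR].

(* [fine] is harmless for strongly convex [f], whose conjugate is finite. *)
Definition grad_conjugate f t : R := derive1 (fine \o conjugate f) t.

End generators.

Section divergences.
Context {R : realType} {d : nat}.
Local Notation Rd := (d.-tuple R).
Local Notation leb := (@lebesgue_tuple R d).
Implicit Types (X : set Rd) (P : probability Rd R) (p q T : Rd -> R).

(* A probability measure on X is seen as a measure on R^d; the last clause with
   A = ~` X shows that it is carried by X. *)
Definition has_density X P p :=
  [/\ measurable_fun X p, forall x, X x -> 0 <= p x &
      forall A, measurable A -> P A = (\int[leb]_(x in A `&` X) (p x)%:E)%E].

Definition same_support X p q :=
  {ae leb, forall x, X x -> (0 < p x <-> 0 < q x)}.

Definition support X q := X `&` [set x | 0 < q x].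

Definition divergence (h : R -> R) X p q : \bar R :=
  (\int[leb]_(x in support X q) (q x * h (p x / q x))%:E)%E.

Definition dual_estimate (f : R -> R) X P Q T : \bar R :=
  (\int[P]_(x in X) (T x)%:E - \int[Q]_(x in X) conjugate f (T x))%E.

Definition primal_estimate (f g : R -> R) X q T : \bar R :=
  (\int[leb]_(x in support X q) (q x * g (grad_conjugate f (T x)))%:E)%E.

End divergences.

(* Main.v *)
(* Write [u t] for the maximizer of [v |-> t v - f v] on [0, +oo[; it exists by
   strong convexity and lower semicontinuity, and it is the gradient of the
   conjugate [f^*].  Strong convexity sharpens the Fenchel-Young inequality to
     mu / 2 * (v - u t)^2 <= f v + f^* t - t v.
   At [v = p / q] and [t = T], weighted by [q] and integrated, its right-hand
   side becomes the gap between [D_f] and the dual estimate, so that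
   [E_q (p / q - r)^2 <= 2 eps / mu].  Then [E_q |p / q - r|] is at most
   [sqrt (2 eps / mu)], and the Lipschitz bound on [g] concludes. *)

Require Import Defs.
From mathcomp Require Import all_boot all_order all_algebra.
From mathcomp Require Import all_classical all_reals all_analysis.
From mathcomp Require Import unstable measurable_realfun ring lra.

Import Order.TTheory GRing.Theory Num.Theory.
Import numFieldNormedType.Exports.

Local Open Scope classical_set_scope.
Local Open Scope ring_scope.

Set Implicit Arguments.
Unset Strict Implicit.

(** * Strong convexity and minimizers on the half-line *)

(** The last term is the defect of the square in Jensen's inequality: [l x^2 + (1 - l) y^2 - (l x +
    (1 - l) y)^2 = l (1 - l) (x - y)^2]. *)
Lemma strongly_convexP (R : realType) (mu : R) (f : R -> R) :
  strongly_convex mu f ->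
  forall l x y, 0 <= l <= 1 -> 0 <= x -> 0 <= y ->
  f (l * x + (1 - l) * y) <=
    l * f x + (1 - l) * f y - mu / 2 * (l * (1 - l) * (x - y) ^+ 2).
Proof.
move=> scf l x y /andP[l0 l1] x0 y0.
have nneg (z : R) : 0 <= z -> z \in @nnegR R.
  by move=> z0; rewrite inE /nnegR /= in_itv /= z0.
have li : Itv.spec (@Itv.num_sem R) (Itv.Real `[0%Z, 1%Z]) l.
  by apply/and3P; split; rewrite ?in_itv /= ?l0 ?l1 ?realE ?l0.
have := scf (Itv.mk li) x y (nneg x x0) (nneg y y0).
rewrite !convRE /= /onem -[conv _ _ _]/(l * x + (1 - l) * y); lra.
Qed.

(** Linear terms cancel in the convexity inequality. Minimizers of the tilted function are the
    maximizers in the supremum defining [f^*(t)]. *)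
Lemma strongly_convex_tilt (R : realType) (mu t : R) (f : R -> R) :
  strongly_convex mu f -> strongly_convex mu (fun u => f u - t * u).
Proof.
move=> scf l x y x0 y0; have := scf l x y x0 y0.
rewrite !convRE /= /onem -[conv _ _ _]/(l%:num * x + (1 - l%:num) * y); lra.
Qed.

(* The chords from 1 to 0 and from 1 to 2, extended beyond 1, bound [f] from
   below on [1, +oo[ and on [0, 1] respectively. *)
Lemma strongly_convex_bounded_below (R : realType) (mu : R) (f : R -> R) :
  0 < mu -> strongly_convex mu f -> exists m, forall u, 0 <= u -> m <= f u.
Proof.
move=> mu0 /strongly_convexP scf.
pose c := `|f 0| + `|f 1| + `|f 2|.
have n0 := normr_ge0 (f 0); have n1 := normr_ge0 (f 1).
have n2 := normr_ge0 (f 2).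
have [a0 a0'] : - `|f 0| <= f 0 /\ f 0 <= `|f 0|.
  by rewrite ler_norm lerNl -normrN ler_norm.
have [a1 a1'] : - `|f 1| <= f 1 /\ f 1 <= `|f 1|.
  by rewrite ler_norm lerNl -normrN ler_norm.
have [a2 a2'] : - `|f 2| <= f 2 /\ f 2 <= `|f 2|.
  by rewrite ler_norm lerNl -normrN ler_norm.
(* On [[0, 1]] the chord gives the bound [- 2 c]. Beyond 1 it gives [- c - 2 c s + mu / 2 * s^2]
   with [s = u - 1], whose minimum is [- c - (2 c)^2 / (2 mu)]. The witness lies below both. *)
exists (- (2 * c + (2 * c) ^+ 2 / mu)) => u u0.
have c0 : 0 <= (2 * c) ^+ 2 / mu by rewrite divr_ge0 ?sqr_ge0 ?ltW.
have [u1|u1] := leP u 1.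
  have k0 : 0 < 2 - u by lra.
  have := scf (2 - u)^-1 u 2; rewrite invr_ge0 ltW // invf_le1 // u0.
  rewrite (_ : 1 <= 2 - u); last lra.
  rewrite (_ : _ * u + _ = 1); last by field; lra.
  move=> /(_ isT isT (ler0n _ _)).
  rewrite -(ler_pM2l k0) => h.
  have e : (2 - u) * ((2 - u)^-1 * f u + (1 - (2 - u)^-1) * f 2 -
      mu / 2 * ((2 - u)^-1 * (1 - (2 - u)^-1) * (u - 2) ^+ 2)) =
      f u + (1 - u) * f 2 - mu / 2 * ((1 - u) * (2 - u)).
    by field; lra.
  rewrite e in h.
  have : 0 <= mu / 2 * ((1 - u) * (2 - u)).
    by rewrite mulr_ge0 ?mulr_ge0 ?divr_ge0; lra.
  rewrite /c in c0 *; nra.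
have k0 : 0 < u by lra.
have := scf u^-1 u 0; rewrite invr_ge0 u0 invf_le1 // (ltW u1) lexx.
rewrite (_ : _ * u + _ = 1); last by field; lra.
move=> /(_ isT isT isT).
rewrite -(ler_pM2l k0) => h.
have e : u * (u^-1 * f u + (1 - u^-1) * f 0 -
    mu / 2 * (u^-1 * (1 - u^-1) * (u - 0) ^+ 2)) =
    f u + (u - 1) * f 0 - mu / 2 * ((u - 1) * u).
  by field; lra.
rewrite e in h.
have cu : f u >= - c - 2 * c * (u - 1) + mu / 2 * (u - 1) ^+ 2.
  have : 0 <= mu / 2 * (u - 1) by rewrite mulr_ge0 ?divr_ge0; lra.
  rewrite /c; nra.
apply: le_trans cu.
have : 0 <= mu * (u - 1 - 2 * c / mu) ^+ 2 by rewrite mulr_ge0 ?sqr_ge0 ?ltW.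
have -> : mu * (u - 1 - 2 * c / mu) ^+ 2 =
    mu * (u - 1) ^+ 2 - 4 * c * (u - 1) + (2 * c) ^+ 2 / mu by field; lra.
have : 0 <= c by rewrite /c; lra.
lra.
Qed.

(** Completeness takes the place of compactness: strong convexity makes a minimizing sequence
    Cauchy, and lower semicontinuity passes to its limit. *)
Lemma strongly_convex_attains_min (R : realType) (mu : R) (f : R -> R) :
  0 < mu -> strongly_convex mu f -> lower_semicontinuous (ext_pinfty f) ->
  exists2 u, 0 <= u & forall v, 0 <= v -> f u <= f v.
Proof.
move=> mu0 scf lf.
have [b bf] := strongly_convex_bounded_below mu0 scf.
pose S := f @` [set v | 0 <= v].
have S0 : S !=set0 by exists (f 0), 0 => //=.
have lS : has_lbound S by exists b => _ [v /= v0 <-]; exact: bf.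
pose m := inf S.
have mf v : 0 <= v -> m <= f v by move=> v0; apply: ge_inf => //; exists v.
have near n : exists u, 0 <= u /\ f u < m + n.+1%:R^-1.
  have [//|_ [u /= u0 <-] fu] := @inf_adherent _ S n.+1%:R^-1 _ (conj S0 lS).
  by exists u.
pose u n := projT1 (cid (near n)).
have u0 n : 0 <= u n by rewrite /u; case: cid => ? [].
have fu n : f (u n) < m + n.+1%:R^-1 by rewrite /u; case: cid => ? [].
(* By strong convexity at the midpoint, near-minimizers are close. *)
have close d x y : 0 <= x -> 0 <= y -> f x < m + d -> f y < m + d ->
    mu / 8 * (x - y) ^+ 2 < d.
  move=> x0 y0 fx fy.
  have := strongly_convexP scf (l := 2^-1) (x := x) (y := y).
  have -> : 0 <= 2^-1 :> R by lra.
  have -> : 2^-1 <= 1 :> R by lra.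
  move=> /(_ isT x0 y0).
  have := mf (2^-1 * x + (1 - 2^-1) * y).
  have -> : 0 <= 2^-1 * x + (1 - 2^-1) * y by lra.
  move=> /(_ isT); lra.
have uc : cvgn u.
  apply/cauchy_cvgP/cauchy_exP => e e0.
  (* Values within [mu / 8 * e^2] of the infimum force points within distance [e]. *)
  have d0 : 0 < mu / 8 * e ^+ 2 by rewrite mulr_gt0 ?exprn_gt0//; lra.
  have [N _ HN] := near_infty_natSinv_lt (PosNum d0).
  exists (u N), N => // n /= Nn.
  rewrite /ball /= -(@ltr_pXn2r _ 2%N) ?nnegrE ?(ltW e0)//.
  rewrite real_normK ?num_real// -(@ltr_pM2l _ (mu / 8)); last lra.
  apply: lt_trans (HN N (leqnn N)).
  apply: close => //; apply: (lt_le_trans (fu n)).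
  by rewrite lerD2l lef_pV2 ?posrE// ler_nat.
pose l := limn u.
have ul : u @ \oo --> l by [].
have l0 : 0 <= l by apply: limr_ge => //; exact: nearW.
exists l => // v v0; rewrite leNgt; apply/negP => fvl.
(* Near [l] semicontinuity keeps [f] above the level [a], while [f (u n)] falls below [a] because it
   tends to [m]. *)
have [a /andP[ma al]] : exists a, m < a < f l.
  have /midf_lt : m < f l by exact: le_lt_trans (mf v v0) fvl.
  by move=> [? ?]; exists ((m + f l) / 2); apply/andP.
have [|V Vl HV] := lf l a; first by rewrite /ext_pinfty l0 lte_fin.
have am0 : 0 < a - m by lra.
have := near_infty_natSinv_lt (PosNum am0).
have := ul V Vl => -[N1 _ H1] [N2 _ H2].
have /= := HV _ (H1 (maxn N1 N2) (leq_maxl _ _)).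
rewrite /ext_pinfty u0 lte_fin.
have h2 : (maxn N1 N2).+1%:R^-1 < a - m := H2 (maxn N1 N2) (leq_maxr _ _).
move: (fu (maxn N1 N2)) h2; move: (_.+1%:R^-1) => k; lra.
Qed.

Lemma strongly_convex_quadratic_growth (R : realType) (mu u : R) (f : R -> R) :
  0 < mu -> strongly_convex mu f ->
  0 <= u -> (forall v, 0 <= v -> f u <= f v) ->
  forall v, 0 <= v -> f u + mu / 2 * (v - u) ^+ 2 <= f v.
Proof.
move=> mu0 scf u0 umin v v0; rewrite leNgt; apply/negP.
set c := mu / 2 * (v - u) ^+ 2 => h.
have c0 : 0 < c by have := umin v v0; lra.
(* Minimality of [u] along the segment to [v] gives [(1 - l) * c <= f v - f u]. This [l] makes the
   left side the midpoint of [f v - f u] and [c], a contradiction when [f v - f u < c]. *)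
pose l := (1 - (f v - f u) / c) / 2.
have dc0 : 0 <= (f v - f u) / c by rewrite divr_ge0 ?(ltW c0) // subr_ge0 umin.
have dc1 : (f v - f u) / c < 1 by rewrite ltr_pdivrMr// mul1r; lra.
have dcE : (f v - f u) / c * c = f v - f u by rewrite divfK// gt_eqF.
have l0 : 0 < l by rewrite /l; lra.
have l1 : l <= 1 by rewrite /l; lra.
have := strongly_convexP scf (l := l) (x := v) (y := u).
rewrite (ltW l0) l1 => /(_ isT v0 u0).
have -> : mu / 2 * (l * (1 - l) * (v - u) ^+ 2) = l * ((1 - l) * c).
  by rewrite /c; ring.
have w0 : 0 <= l * v + (1 - l) * u.
  by rewrite addr_ge0 ?mulr_ge0//; lra.
have := umin _ w0 => h1 h2.
have : l * ((f v - f u) - (1 - l) * c) >= 0 by lra.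
rewrite pmulr_rge0//.
have -> : (1 - l) * c = c / 2 + (f v - f u) / 2.
  transitivity (c / 2 + (f v - f u) / c * c / 2); last by rewrite dcE.
  by rewrite /l; field; rewrite gt_eqF.
lra.
Qed.

(** * The conjugate and its gradient *)

Lemma derive1_quadratic (R : realType) (phi : R -> R) (t a C : R) :
  (forall s, `|phi s - phi t - (s - t) * a| <= C * (s - t) ^+ 2) ->
  derive1 phi t = a.
Proof.
move=> H; rewrite /derive1; apply/cvg_lim => //.
apply/cvgrPdist_le => e e0.
(* Adding 1 gives a positive divisor whatever the sign of [C]. *)
have C0 : 0 < `|C| + 1 by rewrite ltr_wpDl.
near=> h.
have h0 : h != 0 by near: h; exact: nbhs_dnbhs_neq.
have he : `|h| <= e / (`|C| + 1).
  near: h; apply: dnbhs0_le; exact: divr_gt0.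
rewrite distrC /= /GRing.scale /=.
have -> : h^-1 * (phi (h + t) - phi t) - a =
    h^-1 * (phi (h + t) - phi t - (h + t - t) * a) by field.
rewrite normrM normfV ler_pdivrMl ?normr_gt0//.
apply: le_trans (H _) _.
rewrite addrK -real_normK ?num_real// expr2 mulrA mulrC ler_pM2l ?normr_gt0//.
apply: (@le_trans _ _ ((`|C| + 1) * `|h|)).
  by rewrite ler_wpM2r// (le_trans (ler_norm C))// lerDl.
by rewrite mulrC -ler_pdivlMr.
Unshelve. all: by end_near. Qed.

(* [u] selects the maximizers in the definition of the conjugate [f^*]; the
   quadratic gap below them makes [u] the gradient of [f^*]. *)
Lemma conjugate_maximizer (R : realType) (mu : R) (f : R -> R) :
  0 < mu -> strongly_convex mu f -> lower_semicontinuous (ext_pinfty f) ->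
  exists u : R -> R, [/\ forall t, 0 <= u t,
    forall t, conjugate f t = (t * u t - f (u t))%:E &
    forall t v, 0 <= v ->
      t * v - f v + mu / 2 * (v - u t) ^+ 2 <= t * u t - f (u t)].
Proof.
move=> mu0 scf lf.
have ex (t : R) : exists u : R, 0 <= u /\ forall v, 0 <= v ->
    t * v - f v + mu / 2 * (v - u) ^+ 2 <= t * u - f u.
  have scft := strongly_convex_tilt t scf.
  have [|u u0 umin] := strongly_convex_attains_min mu0 scft.
    move=> x a; rewrite /ext_pinfty; case: ifPn => x0; last first.
      have xlt0 : x < 0 by rewrite ltNge.
      move=> _; exists [set y | y < 0]; first exact: lt_nbhsl.
      by move=> y /= y0; rewrite leNgt y0 ltry.
    rewrite lte_fin => hx.
    (* Half of the slack above [a] is spent on the semicontinuity of [f], half on the continuity of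
       the linear term. *)
    pose e := (f x - t * x - a) / 2.
    have e0 : 0 < e by rewrite /e; lra.
    have [|V Vx HV] := lf x (f x - e).
      by rewrite /ext_pinfty x0 lte_fin; lra.
    have cx : {for x, continuous (fun y => t * y)} by exact: mulrl_continuous.
    have /cvgrPdist_lt /(_ e e0) cxe := cx.
    exists (V `&` [set y | `|t * x - t * y| < e]); first exact: filterI.
    move=> y [/HV /=]; rewrite /ext_pinfty; case: ifPn => [y0|_ _ _]; last first.
      exact: ltry.
    rewrite !lte_fin ltr_norml => h1 /andP[h2 h3]; rewrite /e in h1 h2 h3.
    lra.
  exists u; split => // v v0.
  have := strongly_convex_quadratic_growth mu0 scft u0 umin v0; lra.
pose u t := projT1 (cid (ex t)).
have u0 t : 0 <= u t by rewrite /u; case: cid => ? [].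
have ug t v : 0 <= v -> t * v - f v + mu / 2 * (v - u t) ^+ 2 <= t * u t - f (u t).
  by rewrite /u; case: cid => ? [] /= ? ; exact.
exists u; split => // t.
apply/le_anti/andP; split.
  apply: ge_ereal_sup => _ [v + <-]; rewrite /nnegR /= in_itv /= andbT => v0.
  rewrite lee_fin; apply: le_trans (ug t v v0).
  by rewrite lerDl mulr_ge0 ?sqr_ge0// divr_ge0// ltW.
apply: ereal_sup_ubound; exists (u t) => //.
by rewrite /nnegR /= in_itv /= u0.
Qed.

(** The gap at [s] tested with [u t] shows that [f^* s - f^* t - (s - t) * u t] is nonnegative. The
    gap at [t] tested with [u s], after completing the square, bounds it by [(s - t)^2 / (2 mu)]. *)
Lemma grad_conjugate_maximizer (R : realType) (mu : R) (f u : R -> R) :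
  0 < mu -> (forall t, 0 <= u t) ->
  (forall t, conjugate f t = (t * u t - f (u t))%:E) ->
  (forall t v, 0 <= v ->
    t * v - f v + mu / 2 * (v - u t) ^+ 2 <= t * u t - f (u t)) ->
  grad_conjugate f = u.
Proof.
move=> mu0 u0 cu ug; apply/funext => t.
apply: (@derive1_quadratic _ _ t (u t) (1 / (2 * mu))) => s.
rewrite /= !cu /=.
have h1 := ug s (u t) (u0 t); have h2 := ug t (u s) (u0 s).
have k0 : 0 <= mu / 2 * (u t - u s) ^+ 2 by rewrite mulr_ge0 ?sqr_ge0//; lra.
have sq : 0 <= mu / 2 * (u s - u t - (s - t) / mu) ^+ 2.
  by rewrite mulr_ge0 ?sqr_ge0//; lra.
have sqE : mu / 2 * (u s - u t - (s - t) / mu) ^+ 2 = mu / 2 * (u s - u t) ^+ 2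
   - (s - t) * (u s - u t) + 1 / (2 * mu) * (s - t) ^+ 2 by field; lra.
have c0 : 0 <= 1 / (2 * mu) * (s - t) ^+ 2.
  by rewrite mulr_ge0 ?sqr_ge0// divr_ge0//; lra.
by rewrite ler_norml; apply/andP; split; lra.
Qed.

(** Adding the gap inequalities at [s] and [t], each tested with the other maximizer, yields
    [0 <= (t - s) * (u t - u s)]. Monotonicity then makes [u] Borel, hence [u \o T] measurable. *)
Lemma maximizer_nondecreasing (R : realType) (mu : R) (f u : R -> R) :
  0 < mu -> (forall t, 0 <= u t) ->
  (forall t v, 0 <= v ->
    t * v - f v + mu / 2 * (v - u t) ^+ 2 <= t * u t - f (u t)) ->
  {homo u : s t / s <= t}.
Proof.
move=> mu0 u0 ug s t; rewrite le_eqVlt => /predU1P[->//|st].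
have h1 := ug s (u t) (u0 t); have h2 := ug t (u s) (u0 s).
have k1 : 0 <= mu / 2 * (u t - u s) ^+ 2 by rewrite mulr_ge0 ?sqr_ge0//; lra.
have k2 : 0 <= mu / 2 * (u s - u t) ^+ 2 by rewrite mulr_ge0 ?sqr_ge0//; lra.
have : 0 <= (t - s) * (u t - u s) by lra.
by rewrite pmulr_rge0 ?subr_ge0 // subr_gt0.
Qed.

(** * Integrals against a measure with a density *)

Lemma ae_eq0_integral (d : measure_display) (T : measurableType d)
    (R : realType) (mu : {measure set T -> \bar R}) (X D : set T)
    (F : T -> \bar R) :
  measurable X -> measurable D -> D `<=` X -> measurable_fun X F ->
  {ae mu, forall x, X x -> ~ D x -> F x = 0%E} ->
  (\int[mu]_(x in X) F x = \int[mu]_(x in D) F x)%E.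
Proof.
move=> mX mD DX mF F0.
rewrite -[in RHS](setIidr DX) integral_mkcondr.
apply: ae_eq_integral => //.
  apply/(measurable_restrict _ mD mX).
  by apply: measurable_funS mF => // x [].
apply: filterS F0 => x /= F0 Xx; rewrite patchE; case: ifPn => // /negP.
by rewrite inE; exact: F0.
Qed.

Section density.
Local Open Scope ereal_scope.
Context (d : measure_display) (T : measurableType d) (R : realType).
Variables (mu : {sigma_finite_measure set T -> \bar R}).
Variables (nu : {finite_measure set T -> \bar R}) (X : set T) (q : T -> R).
Hypotheses (mX : measurable X) (mq : measurable_fun X q).
Hypothesis q0 : forall x, X x -> (0 <= q x)%R.
Hypothesis nuE : forall A, measurable A ->
  nu A = \int[mu]_(x in A `&` X) (q x)%:E.

Lemma density_integrable : mu.-integrable X (EFin \o q).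
Proof.
apply/integrableP; split; first exact/measurable_EFinP.
rewrite (eq_integral (EFin \o q)); last first.
  by move=> x; rewrite inE => Xx; rewrite /= ger0_norm ?q0.
rewrite -[X in integral _ X _]setTI -nuE//.
exact: fin_num_fun_lty.
Qed.

Let numu : nu `<< mu.
Proof.
apply/null_content_dominatesP => A mA A0; rewrite nuE//.
apply: null_set_integral.
- exact: measurableI.
- by apply/measurable_EFinP; apply: measurable_funS mq => // x [].
- apply/eqP; rewrite eq_le measure_ge0 andbT -A0.
  by apply: le_measure; rewrite ?inE//; exact: measurableI.
Qed.

Let RN := Radon_Nikodym (charge_of_finite_measure nu) mu.

(** Both functions integrate to [nu E] over each measurable [E] inside [X]. The Radon-Nikodym change
    of variables thus transfers to the given [q]. *)
Let RNE : ae_eq mu X RN (EFin \o q).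
Proof.
apply: integral_ae_eq => //.
- apply: (integrableS measurableT) => //; exact: Radon_Nikodym_integrable.
- exact/measurable_EFinP.
- move=> E EX mE; rewrite /RN -Radon_Nikodym_integral// -[LHS]/(nu E) nuE//.
  by rewrite setIidl.
Qed.

Let mRN : measurable_fun X RN.
Proof.
apply: measurable_funTS; apply: measurable_int.
exact: Radon_Nikodym_integrable.
Qed.

Let integral_density_E (h : T -> \bar R) : nu.-integrable X h ->
  \int[nu]_(x in X) h x = \int[mu]_(x in X) (h x * (q x)%:E).
Proof.
move=> ih; have mh := measurable_int _ ih.
rewrite -(Radon_Nikodym_change_of_variables numu)//.
apply: ae_eq_integral => //.
- exact: emeasurable_funM.
- by apply: emeasurable_funM => //; exact/measurable_EFinP.
- exact: ae_eqe_mul2l.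
Qed.

(** Since [q] is nonnegative, the change of variables applied to the absolute value of [h] gives the
    finiteness. *)
Lemma integrable_density (h : T -> \bar R) : nu.-integrable X h ->
  mu.-integrable X (fun x => h x * (q x)%:E).
Proof.
move=> ih; have mh := measurable_int _ ih.
apply/integrableP; split.
  by apply: emeasurable_funM => //; exact/measurable_EFinP.
have := integrable_abse ih => iah.
rewrite (eq_integral (fun x => `|h x| * (q x)%:E)); last first.
  by move=> x; rewrite inE => Xx; rewrite abseM /= ger0_norm ?q0.
by rewrite -integral_density_E//; apply: integrable_lty.
Qed.

Lemma integral_density (D : set T) (h : T -> \bar R) :
  measurable D -> D `<=` X -> nu.-integrable X h ->
  {ae mu, forall x, X x -> ~ D x -> q x = 0%R} ->
  \int[nu]_(x in X) h x = \int[mu]_(x in D) (h x * (q x)%:E).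
Proof.
move=> mD DX ih qD; rewrite integral_density_E//.
apply: ae_eq0_integral => //; first exact: measurable_int (integrable_density ih).
by apply: filterS qD => x qD Xx Dx; rewrite qD// mule0.
Qed.

End density.

(** * From a weighted second moment to a weighted first moment *)

(* AM-GM: [2 |w| <= w^2 / k + k] *)
Lemma weighted_norm_le (R : realType) (k q w z : R) :
  0 < k -> 0 <= q -> q * w ^+ 2 <= z ->
  q * `|w| <= (2 * k)^-1 * z + k / 2 * q.
Proof.
move=> k0 q0 h.
have h' : (2 * k)^-1 * (q * w ^+ 2) <= (2 * k)^-1 * z.
  by rewrite ler_wpM2l ?invr_ge0//; lra.
apply: le_trans (lerD h' (lexx _)).
rewrite -(real_normK (num_real w)) -subr_ge0.
have -> : (2 * k)^-1 * (q * `|w| ^+ 2) + k / 2 * q - q * `|w| =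
    q * ((`|w| - k) ^+ 2 / (2 * k)) by field; lra.
by rewrite mulr_ge0 ?divr_ge0 ?sqr_ge0//; lra.
Qed.

(* Optimizing the AM-GM bound in [k] replaces the Cauchy-Schwarz inequality. *)
Lemma integral_weighted_norm_le_sqrt (d : measure_display)
    (T : measurableType d) (R : realType) (mu : {measure set T -> \bar R})
    (D : set T) (q w z : T -> R) (S : R) :
  measurable D -> (forall x, D x -> 0 <= q x) ->
  mu.-integrable D (EFin \o q) -> (\int[mu]_(x in D) (q x)%:E = 1)%E ->
  measurable_fun D w -> mu.-integrable D (EFin \o z) ->
  (forall x, D x -> q x * w x ^+ 2 <= z x) ->
  0 <= S -> (\int[mu]_(x in D) (z x)%:E <= S%:E)%E ->
  mu.-integrable D (fun x => (q x * `|w x|)%:E) /\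
  (\int[mu]_(x in D) (q x * `|w x|)%:E <= (Num.sqrt S)%:E)%E.
Proof.
move=> mD q0 iq q1 mw iz wz S0 zS.
have mq : measurable_fun D q by apply/measurable_EFinP; exact: measurable_int iq.
have mqw : measurable_fun D (fun x => (q x * `|w x|)%:E).
  by apply/measurable_EFinP; apply: measurable_funM => //; exact: measurableT_comp.
have ib (k : R) : mu.-integrable D
    (fun x => ((2 * k)^-1 * z x + k / 2 * q x)%:E).
  have := integrableD mD (integrableZl mD (2 * k)^-1 iz) (integrableZl mD (k / 2) iq).
  by apply: eq_integrable.
have le k x : 0 < k -> D x ->
    q x * `|w x| <= (2 * k)^-1 * z x + k / 2 * q x.
  by move=> k0 Dx; apply: weighted_norm_le => //; [exact: q0|exact: wz].
have iqw : mu.-integrable D (fun x => (q x * `|w x|)%:E).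
  apply: le_integrable (ib 1) => //= x Dx.
  rewrite lee_fin ger0_norm ?mulr_ge0 ?q0//.
  by apply: le_trans (ler_norm _); exact: le.
split=> //.
have bound k : 0 < k ->
    (\int[mu]_(x in D) (q x * `|w x|)%:E <= ((2 * k)^-1 * S + k / 2)%:E)%E.
  move=> k0.
  apply: (@le_trans _ _ (\int[mu]_(x in D) ((2 * k)^-1 * z x + k / 2 * q x)%:E)%E).
    by apply: le_integral => // x; rewrite inE => Dx; rewrite lee_fin le.
  under eq_integral do rewrite EFinD !EFinM.
  rewrite integralD//; [|exact: integrableZl..].
  rewrite !integralZl// q1 mule1 EFinD leeD2r// EFinM lee_wpmul2l//.
  by rewrite lee_fin invr_ge0 mulr_ge0 ?ler0n// ltW.
(* The optimal [k] is [sqrt S], which is not positive when [S = 0]; there [k = 2 * e] gives the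
   bound [e] for every [e > 0]. *)
have [S0'|Sn0] := eqVneq S 0.
  rewrite S0' sqrtr0; apply/lee_addgt0Pr => e e0.
  have e20 : 0 < 2 * e by rewrite mulr_gt0.
  apply: (le_trans (bound _ e20)).
  by rewrite add0e lee_fin S0' mulr0 add0r mulrC mulKf.
have k0 : 0 < Num.sqrt S by rewrite sqrtr_gt0 lt_neqAle eq_sym Sn0.
apply: (le_trans (bound _ k0)); rewrite lee_fin.
rewrite -{2}(sqr_sqrtr S0) le_eqVlt; apply/orP; left; apply/eqP.
by field; rewrite gt_eqF.
Qed.

(** * Measurability and pointwise bounds for the integrands *)

(** Lower semicontinuous functions are Borel, and the value [+oo] is never met along a nonnegative
    [w]. *)
Lemma measurable_ext_pinfty_comp (d : measure_display) (S : measurableType d)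
    (R : realType) (D : set S) (h : R -> R) (w : S -> R) :
  lower_semicontinuous (ext_pinfty h) -> measurable D ->
  measurable_fun D w -> (forall x, D x -> 0 <= w x) ->
  measurable_fun D (h \o w).
Proof.
move=> /lower_semicontinuous_measurable mh mD mw w0.
apply/measurable_EFinP.
apply: eq_measurable_fun (measurableT_comp mh mw) => x; rewrite inE => Dx /=.
by rewrite /ext_pinfty w0.
Qed.

Lemma measurable_ratio (d : measure_display) (S : measurableType d)
    (R : realType) (D : set S) (p q : S -> R) :
  measurable D -> measurable_fun D p -> measurable_fun D q ->
  (forall x, D x -> 0 < q x) -> measurable_fun D (fun x => p x / q x).
Proof.
move=> mD mp mq q0; apply: measurable_funM => //.
have minv : measurable_fun (`]0, +oo[%classic : set R) (fun x : R => x^-1).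
  apply: open_continuous_measurable_fun; first exact: interval_open.
  move=> x; rewrite inE /= in_itv /= andbT => x0.
  by apply: inv_continuous; rewrite gt_eqF.
apply: (measurable_comp _ _ minv mq) => // _ /= [x Dx <-].
by rewrite in_itv /= q0.
Qed.

Lemma lipschitz_nnegP (R : realType) (sigma : R) (g : R -> R) :
  sigma.-lipschitz_(nnegR) g ->
  forall x y, 0 <= x -> 0 <= y -> `|g x - g y| <= sigma * `|x - y|.
Proof.
by move=> lipg x y x0 y0; apply: (lipg (x, y)); split; rewrite /= /nnegR /= in_itv /= ?x0 ?y0.
Qed.

Lemma lipschitz_nneg_ge0 (R : realType) (sigma : R) (g : R -> R) :
  sigma.-lipschitz_(nnegR) g -> 0 <= sigma.
Proof.
move=> /lipschitz_nnegP /(_ 1 0 ler01 (lexx 0)).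
by rewrite subr0 normr1 mulr1; exact: le_trans.
Qed.

(** This is the sharpened Fenchel-Young inequality multiplied by [2 q / mu]; the bracket becomes the
    integrand of the duality gap. *)
Lemma weighted_dual_gap (R : realType) (mu p q t u : R) (f : R -> R) :
  0 < mu -> 0 < q ->
  t * (p / q) - f (p / q) + mu / 2 * (p / q - u) ^+ 2 <= t * u - f u ->
  q * (p / q - u) ^+ 2 <=
    2 / mu * (q * f (p / q) + (t * u - f u) * q - t * p).
Proof.
move=> mu0 q0 h; rewrite -subr_ge0.
have qmu0 : 0 <= 2 / mu * q by rewrite mulr_ge0 ?divr_ge0// ltW.
have := mulr_ge0 qmu0 (etrans (subr_ge0 _ _) h); congr (0 <= _).
by field; rewrite !gt_eqF.
Qed.

(** Comparison with the value [g 1 = 0] dominates the integrand of [D_g] by a multiple of [p + q],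
    which makes it integrable. *)
Lemma weighted_lipschitz_le (R : realType) (sigma p q : R) (g : R -> R) :
  sigma.-lipschitz_(nnegR) g -> g 1 = 0 -> 0 <= p -> 0 < q ->
  `|q * g (p / q)| <= sigma * (p + q).
Proof.
move=> lipg g1 p0 q0; have s0 := lipschitz_nneg_ge0 lipg.
have r0 : 0 <= p / q by rewrite divr_ge0// ltW.
have := lipschitz_nnegP lipg r0 ler01; rewrite g1 subr0 => h.
rewrite normrM gtr0_norm//.
have -> : sigma * (p + q) = q * (sigma * (p / q + 1)).
  by field; rewrite gt_eqF.
rewrite ler_pM2l//; apply: (le_trans h); rewrite ler_wpM2l//.
by rewrite (le_trans (ler_normB _ _))// normr1 (ger0_norm r0).
Qed.

(** * From the duality gap to the error of the primal estimate *)

Unset Implicit Arguments.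
Set Strict Implicit.

Theorem theorem5p3 (R : realType) (d : nat) (X : set (d.-tuple R))
    (P Phat : probability (d.-tuple R) R) (p phat : d.-tuple R -> R)
    (f g : R -> R) (mu sigma eps : R) (T : d.-tuple R -> R)
    (mX : measurable X)
    (Pp : has_density X P p) (Pphat : has_density X Phat phat)
    (p_phat : same_support X p phat)
    (cf : convex_lsc f) (cg : convex_lsc g) (f1 : f 1 = 0) (g1 : g 1 = 0)
    (mu0 : 0 < mu) (scf : strongly_convex mu f)
    (lipg : sigma.-lipschitz_(nnegR) g)
    (mT : measurable_fun X T) (eps0 : 0 <= eps)
    (Df_fin : divergence f X p phat \is a fin_num)
    (T_int : P.-integrable X (EFin \o T))
    (fT_int : Phat.-integrable X (conjugate f \o T)) :
  (divergence f X p phat - dual_estimate f X P Phat T <= eps%:E)%E ->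
  (`| divergence g X p phat - primal_estimate f g X phat T |
     <= (sigma * Num.sqrt (2 * eps / mu))%:E)%E.
Proof.
have [mp p0 PE] := Pp; have [mq q0 QE] := Pphat.
rewrite /dual_estimate /divergence /primal_estimate.
set L := lebesgue_tuple d; set D := Defs.support X phat.
have mD : measurable D.
  rewrite /D /Defs.support (_ : [set x | 0 < phat x] = phat @^-1` `]0, +oo[).
    exact: mq.
  by apply/seteqP; split => x /=; rewrite in_itv /= andbT.
have DX : D `<=` X by move=> x [].
have Dq x : D x -> 0 < phat x by move=> [].
have Dp x : D x -> 0 <= p x by move=> /DX /p0.
have qD : {ae L, forall x, X x -> ~ D x -> phat x = 0}.
  apply: aeW => x Xx ND; apply/eqP; rewrite eq_le q0// andbT leNgt.
  by apply/negP => qx; apply: ND.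
(* Off [D], [phat] vanishes everywhere on [X], but [p] only almost everywhere, through the shared
   support. *)
have pD : {ae L, forall x, X x -> ~ D x -> p x = 0}.
  apply: filterS p_phat => x pq Xx ND.
  apply/eqP; rewrite eq_le p0// andbT leNgt.
  by apply/negP => /(pq Xx) qx; apply: ND.
have [u [u0 cu ug]] := conjugate_maximizer mu0 scf cf.2.
rewrite (grad_conjugate_maximizer mu0 u0 cu ug).
have iq : L.-integrable D (EFin \o phat).
  by apply: (integrableS mX mD DX); exact: density_integrable QE.
have ip : L.-integrable D (EFin \o p).
  by apply: (integrableS mX mD DX); exact: density_integrable PE.
have q1 : (\int[L]_(x in D) (phat x)%:E = 1)%E.
  rewrite -(@probability_setT _ _ _ Phat) QE// setTI.
  apply/esym/ae_eq0_integral => //; first exact/measurable_EFinP.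
  by apply: filterS qD => x qD Xx ND; rewrite qD.
pose w x := p x / phat x - u (T x).
have mTD : measurable_fun D T by exact: measurable_funS mT.
have mr : measurable_fun D (u \o T).
  apply: measurableT_comp => //; apply: nondecreasing_measurable => //.
  exact: maximizer_nondecreasing ug.
have mpD : measurable_fun D p by exact: measurable_funS mp.
have mqD : measurable_fun D phat by exact: measurable_funS mq.
have mratio : measurable_fun D (fun x => p x / phat x).
  exact: measurable_ratio.
have ratio0 x : D x -> 0 <= p x / phat x.
  by move=> Dx; rewrite divr_ge0 ?Dp// ltW// Dq.
have mw : measurable_fun D w by exact: measurable_funB.
have mfr : measurable_fun D (fun x => f (p x / phat x)).
  exact: measurable_ext_pinfty_comp cf.2 mD mratio ratio0.
have mgr : measurable_fun D (fun x => g (p x / phat x)).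
  exact: measurable_ext_pinfty_comp cg.2 mD mratio ratio0.
have mgu : measurable_fun D (fun x => g (u (T x))).
  exact: measurable_ext_pinfty_comp cg.2 mD mr (fun x _ => u0 (T x)).
pose a x := phat x * f (p x / phat x).
pose b x := (T x * u (T x) - f (u (T x))) * phat x.
pose c x := T x * p x.
(* An extended integral is finite only if those of the positive and negative parts are, so
   finiteness of [D_f] gives integrability. *)
have ia : L.-integrable D (EFin \o a).
  apply/integrableP; split.
    by apply/measurable_EFinP; exact: measurable_funM.
  by rewrite integral_fin_num_abs//; exact: measurable_funM.
have fT_E x : ((conjugate f \o T) x * (phat x)%:E = (b x)%:E)%E.
  by rewrite /= cu.
have ib : L.-integrable D (EFin \o b).
  apply: (integrableS mX mD DX).
  apply: eq_integrable (integrable_density mX mq q0 QE fT_int) => //.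
have ic : L.-integrable D (EFin \o c).
  apply: (integrableS mX mD DX).
  exact: eq_integrable (integrable_density mX mp p0 PE T_int).
(* The expectations under [P] and [Phat] become Lebesgue integrals over [D], so that the gap is the
   integral of [a + b - c]. *)
rewrite (integral_density mX mp p0 PE mD DX T_int pD).
rewrite (integral_density mX mq q0 QE mD DX fT_int qD).
under [X in (_ - (_ - X))%E]eq_integral do rewrite fT_E.
under [X in (_ - (X - _))%E]eq_integral do rewrite /= -EFinM -/(c _).
under eq_integral do rewrite -/(a _).
move=> gap.
pose z x := 2 / mu * (a x + b x - c x).
have iabc : L.-integrable D (fun x => (a x + b x - c x)%:E).
  by apply: eq_integrable (integrableB mD (integrableD mD ia ib) ic).
have iz : L.-integrable D (EFin \o z).
  by apply: eq_integrable (integrableZl mD (2 / mu) iabc).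
have S0 : 0 <= 2 * eps / mu by rewrite divr_ge0 ?mulr_ge0// ltW.
have zS : (\int[L]_(x in D) (z x)%:E <= (2 * eps / mu)%:E)%E.
  rewrite [2 * eps / mu]mulrAC; under eq_integral do rewrite EFinM.
  rewrite integralZl// [leRHS]EFinM lee_wpmul2l//.
    by rewrite lee_fin divr_ge0// ltW.
  rewrite integralB_EFin//; last exact: eq_integrable (integrableD mD ia ib).
  rewrite integralD_EFin//.
  move: gap; rewrite fin_num_oppeB ?integrable_fin_num//.
  by rewrite addeA addeAC.
have wz x : D x -> phat x * w x ^+ 2 <= z x.
  move=> Dx; apply: weighted_dual_gap => //; first exact: Dq.
  by apply: ug; exact: ratio0.
have [iqw qwS] := integral_weighted_norm_le_sqrt mD
  (fun x Dx => ltW (Dq x Dx)) iq q1 mw iz wz S0 zS.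
have sigma0 := lipschitz_nneg_ge0 lipg.
have ipq : L.-integrable D (fun x => (sigma * (p x + phat x))%:E).
  by apply: eq_integrable (integrableZl mD sigma (integrableD mD ip iq)).
have isqw : L.-integrable D (fun x => (sigma * (phat x * `|w x|))%:E).
  by apply: eq_integrable (integrableZl mD sigma iqw).
have gdiff x : D x ->
    `|phat x * g (p x / phat x) - phat x * g (u (T x))| <=
    sigma * (phat x * `|w x|).
  move=> Dx; rewrite -mulrBr normrM gtr0_norm ?Dq// mulrCA ler_pM2l ?Dq//.
  by apply: lipschitz_nnegP => //; exact: ratio0.
have igr : L.-integrable D (EFin \o (fun x => phat x * g (p x / phat x))).
  apply: le_integrable ipq => //.
    by apply/measurable_EFinP; exact: measurable_funM.
  move=> x Dx; rewrite /= lee_fin (le_trans _ (ler_norm _))//.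
  by apply: weighted_lipschitz_le => //; [exact: Dp|exact: Dq].
(* The integrand of the primal estimate has no direct bound: its difference from that of [D_g] is
   dominated through the Lipschitz estimate, and its own integrability follows by subtraction. *)
have igd : L.-integrable D (EFin \o
    (fun x => phat x * g (p x / phat x) - phat x * g (u (T x)))).
  apply: le_integrable isqw => //.
    by apply/measurable_EFinP; apply: measurable_funB; exact: measurable_funM.
  by move=> x Dx; rewrite /= lee_fin (le_trans _ (ler_norm _))// gdiff.
have igu : L.-integrable D (EFin \o (fun x => phat x * g (u (T x)))).
  apply: eq_integrable (integrableB mD igr igd) => // x _ /=.
  by rewrite -EFinB opprB addrC subrK.
rewrite -integralB_EFin//.
apply: (le_trans (le_abse_integral _ mD (measurable_int _ igd))).
rewrite EFinM; apply: (@le_trans _ _ (sigma%:E * \int[L]_(x in D)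
    (phat x * `|w x|)%:E)%E); last first.
  by rewrite lee_wpmul2l ?lee_fin.
rewrite -integralZl//; apply: le_integral => //.
- exact: integrable_abse.
- by move=> x; rewrite inE => Dx; rewrite /= -EFinM lee_fin; exact: gdiff.
Qed.
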